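(* Let $\mathbf{k}$ be a commutative unital ring, $\Omega$ a nonempty set and $X$ a set disjoint from $\Omega$. For any forests $F_1,F_2\in\mathcal{F}(X,\Omega)$, $$F_1\rhd_{RT}F_2=\sum_{I_{k_2}\lhd F_2}F_{2|I_{k_2}}\,F_1\,F_{2|\overline{I}_{k_2}},$$ and $$[F_1,F_2]_{RT}=\sum_{I_{k_2}\lhd F_2}F_{2|I_{k_2}}\,F_1\,F_{2|\overline{I}_{k_2}}-\sum_{I_{k_1}\lhd F_1}F_{1|I_{k_1}}\,F_2\,F_{1|\overline{I}_{k_1}},$$ where the sums run over the proper biideals of $F_2$ and of $F_1$, respectively.
   Context: A planar rooted tree is a finite rooted tree with a fixed embedding in the plane (so the children of each vertex are ordered from left to right). $\mathcal{T}(X,\Omega)$ is the set of planar rooted trees with vertices decorated by $X\sqcup\Omega$ such that all internal (non-leaf) vertices are decorated by elements of $\Omega$, while leaves may be decorated by any element of $X\sqcup\Omega$; the vertex of a one-vertex tree counts as a leaf. $\mathcal{F}(X,\Omega)$ is the free monoid on $\mathcal{T}(X,\Omega)$ under concatenation $m_{RT}$ (written as juxtaposition), with unit the empty tree $\mathbf{1}$. $H_{RT}(X,\Omega):=\mathbf{k}\mathcal{F}(X,\Omega)$ is the free $\mathbf{k}$-module on $\mathcal{F}(X,\Omega)$, with multiplication extending $m_{RT}$. For $\omega\in\Omega$, $B_\omega^+$ is the linear map on $H_{RT}(X,\Omega)$ sending $\mathbf{1}$ to the one-vertex tree $\bullet_\omega$ and a forest to the tree obtained by grafting its trees (in order) on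 a new root decorated by $\omega$. For an algebra $A$, $a\cdot(b\otimes c)=ab\otimes c$ and $(b\otimes c)\cdot a=b\otimes ca$ on $A\otimes A$. The linear map $\Delta_\epsilon:H_{RT}(X,\Omega)\to H_{RT}(X,\Omega)\otimes H_{RT}(X,\Omega)$ is defined recursively by: $\Delta_\epsilon(\mathbf{1})=0$; $\Delta_\epsilon(\bullet_x)=\mathbf{1}\otimes\mathbf{1}$ for $x\in X$; $\Delta_\epsilon(B_\omega^+(\overline F))=\overline F\otimes\mathbf{1}+(\mathrm{id}\otimes B_\omega^+)\Delta_\epsilon(\overline F)$ for $\overline F\in\mathcal{F}(X,\Omega)$, $\omega\in\Omega$; and $\Delta_\epsilon(T_1\cdots T_m)=T_1\cdot\Delta_\epsilon(T_2\cdots T_m)+\Delta_\epsilon(T_1)\cdot(T_2\cdots T_m)$ for $m\geq2$, $T_i\in\mathcal{T}(X,\Omega)$. One sets $F_1\rhd_{RT}F_2:=\sum_{(F_2)}F_{2(1)}F_1F_{2(2)}$, where $\Delta_\epsilon(F_2)=\sum_{(F_2)}F_{2(1)}\otimes F_{2(2)}$, and $[F_1,F_2]_{RT}:=F_1\rhd_{RT}F_2-F_2\rhd_{RT}F_1$. Orders and biideals: let $V(F)$ be the vertex set of a forest $F=T_1\cdots T_n$, and $u,v\in V(F)$. Write $u\leq_h v$ if there is a directed path from $u$ to $v$ in $F$, edges being oriented from roots to leaves. Write $u\leq_l v$ if $u,v$ are not comparable for $\leq_h$ and either $u$ is a vertex of $T_i$ and $v$ a vertex of $T_j$ with $j<i$,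 or $u,v$ are vertices of the same $T_i$ and $u\leq_l v$ in the forest obtained from $T_i$ by deleting its root. Write $u\leq_{h,l}v$ if $u\leq_h v$ or $u\leq_l v$; this is a total order on $V(F)$. A subset $I\subseteq V(F)$ is a biideal if $u\in I$, $v\in V(F)$, $u\leq_{h,l}v$ imply $v\in I$; it is a proper biideal, written $I\lhd F$, if moreover $I\neq V(F)$. If $u_n\leq_{h,l}\cdots\leq_{h,l}u_1$ are the vertices of $F$, the proper biideals of $F$ are exactly $I_k=\{u_1,\ldots,u_{k-1}\}$, $k=1,\ldots,n$ (with $I_1=\emptyset$), and $\overline{I}_k:=V(F)\setminus(I_k\sqcup\{u_k\})=\{u_{k+1},\ldots,u_n\}$ (with $\overline I_n=\emptyset$). For $I\subseteq V(F)$, $F_{|I}$ is the decorated planar rooted subforest with vertex set $I$ and with edges the edges of $F$ between elements of $I$; $F_{|\emptyset}=\mathbf{1}$ for $F\neq\mathbf{1}$. For $F=\mathbf{1}$ there are no proper biideals and the corresponding sum is empty. *)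

(* Defs.v *)
From HB Require Import structures.
From mathcomp Require Import all_boot all_algebra.
From mathcomp.finmap Require Import finmap.
From mathcomp.multinomials Require Import monalg.

Set Implicit Arguments.
Unset Strict Implicit.
Unset Printing Implicit Defensive.

Import GRing.Theory.
Local Open Scope ring_scope.

(* The carrier is monalg's [{malg k[K]}] (finitely supported functions), but
   monalg only gives it module and ring structures when 1 != 0 in k.  The
   structures are set up here on an alias so that the zero ring is allowed. *)
Definition free_mod (k : comPzRingType) (K : choiceType) : Type := {malg k[K]}.

Section FreeModule.
Context (k : comPzRingType).

HB.instance Definition _ (K : choiceType) :=
  GRing.Zmodule.copy (free_mod k K) {malg k[K]}.

Section Lmodule.
Context (K : choiceType).

Definition fscale (c : k) (g : free_mod k K) : free_mod k K :=
  [malg x in msupp g => c * g@_x].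

Lemma fscaleE c g x : (fscale c g)@_x = c * g@_x.
Proof. by rewrite /fscale mcoeffE; case: msuppP; rewrite ?mulr0. Qed.

Lemma fscaleA a b g : fscale a (fscale b g) = fscale (a * b) g.
Proof. by apply/malgP=> x; rewrite !fscaleE mulrA. Qed.

Lemma fscale1 : left_id 1 fscale.
Proof. by move=> g; apply/malgP=> x; rewrite fscaleE mul1r. Qed.

Lemma fscaleDr : right_distributive fscale +%R.
Proof.
by move=> c g h; apply/malgP=> x; rewrite fscaleE !mcoeffD !fscaleE mulrDr.
Qed.

Lemma fscaleDl g : {morph fscale^~ g : a b / a + b}.
Proof.
by move=> a b; apply/malgP=> x; rewrite fscaleE mcoeffD !fscaleE mulrDl.
Qed.

HB.instance Definition _ := GRing.Zmodule_isLmodule.Build k (free_mod k K)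
  fscaleA fscale1 fscaleDr fscaleDl.

End Lmodule.

End FreeModule.

HB.lock Definition fgen (k : comPzRingType) (K : choiceType) (x : K) :
    free_mod k K := << x >>.
Arguments fgen k {K} x.

HB.lock Definition linext (k : comPzRingType) (K : choiceType) (V : lmodType k)
    (phi : K -> V) (g : free_mod k K) : V :=
  \sum_(x <- msupp g) g@_x *: phi x.

Section FreeModuleTheory.
Context (k : comPzRingType).
Local Notation fgen := (fgen k).

Section LinearExtension.
Context (K : choiceType) (V : lmodType k).

Lemma fgenE (x : K) : fgen x = << x >>.
Proof. by rewrite unlock. Qed.

Lemma linextE (phi : K -> V) (g : free_mod k K) :
  linext phi g = \sum_(x <- msupp g) g@_x *: phi x.
Proof. by rewrite unlock. Qed.

Lemma linextw (phi : K -> V) (d : {fset K}) (g : free_mod k K) :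
  (msupp g `<=` d)%fset -> linext phi g = \sum_(x <- d) g@_x *: phi x.
Proof.
move=> le_gd; rewrite linextE; apply: big_fset_incl => // x _ /mcoeff_outdom ->.
by rewrite scale0r.
Qed.

Lemma linext_is_linear (phi : K -> V) : linear (linext phi).
Proof.
move=> c g h; pose d := (msupp (c *: g + h : {malg k[K]})
  `|` (msupp g `|` msupp h))%fset.
have le1 : (msupp (c *: g + h : {malg k[K]}) `<=` d)%fset by apply: fsubsetUl.
have le2 : (msupp g `<=` d)%fset.
  by apply: fsubset_trans (fsubsetUr _ _); apply: fsubsetUl.
have le3 : (msupp h `<=` d)%fset.
  by apply: fsubset_trans (fsubsetUr _ _); apply: fsubsetUr.
rewrite (linextw phi le1) (linextw phi le2) (linextw phi le3).
rewrite scaler_sumr -big_split /=; apply: eq_bigr => x _.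
by rewrite mcoeffD fscaleE scalerDl scalerA.
Qed.

HB.instance Definition _ (phi : K -> V) :=
  GRing.isLinear.Build k (free_mod k K) V *:%R
    (linext phi) (linext_is_linear phi).

Lemma linext_gen (phi : K -> V) x : linext phi (fgen x) = phi x.
Proof.
by rewrite fgenE (linextw phi msuppU_le) big_seq_fset1 mcoeffUU scale1r.
Qed.

Lemma eq_linext (phi psi : K -> V) : phi =1 psi -> linext phi =1 linext psi.
Proof. by move=> e g; rewrite !linextE; apply: eq_bigr => x _; rewrite e. Qed.

End LinearExtension.

Lemma linext_id (K : choiceType) (g : free_mod k K) : linext (fgen) g = g.
Proof.
rewrite linextE [RHS]monalgE; apply: eq_bigr => x _.
by apply/malgP=> y; rewrite fgenE fscaleE !mcoeffU mulrnAr mulr1.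
Qed.

Lemma free_mod_ind (K : choiceType) (P : free_mod k K -> Prop) :
  P 0 -> (forall c x g, P g -> P (c *: fgen x + g)) -> forall g, P g.
Proof.
move=> P0 PD g; rewrite -[g]linext_id linextE.
by elim: (enum_fset _) => [|x r IHr]; rewrite ?big_nil ?big_cons //; apply: PD.
Qed.

Lemma linext_comp (K : choiceType) (V W : lmodType k)
    (f : {linear V -> W}) (phi : K -> V) g :
  f (linext phi g) = linext (f \o phi) g.
Proof. by rewrite !linextE linear_sum; apply: eq_bigr => x _; rewrite linearZ. Qed.

Section MonoidAlgebra.
Context (K : monoidType).
Implicit Types a b c : free_mod k K.

Definition fmul a b : free_mod k K :=
  linext (fun x => linext (fun y => fgen (x * y)%g) b) a.

Lemma fmulDl : left_distributive fmul +%R.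
Proof. by move=> a b c; rewrite /fmul linearD. Qed.

Lemma fmulZl s a b : fmul (s *: a) b = s *: fmul a b.
Proof. by rewrite /fmul linearZ. Qed.

Lemma fmul_is_linear a : linear (fmul a).
Proof.
move=> s b c; rewrite /fmul ![linext _ a]linextE scaler_sumr -big_split /=.
by apply: eq_bigr => x _; rewrite linearP scalerDr !scalerA mulrC.
Qed.

HB.instance Definition _ a := GRing.isLinear.Build k (free_mod k K)
  (free_mod k K) *:%R (fmul a) (fmul_is_linear a).

Lemma fmulDr : right_distributive fmul +%R.
Proof. by move=> a b c; rewrite linearD. Qed.

Lemma fmul_gen (x y : K) : fmul (fgen x) (fgen y) = fgen (x * y)%g.
Proof. by rewrite /fmul !linext_gen. Qed.

Lemma fmul1 : left_id (fgen 1%g) fmul.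
Proof.
move=> a; rewrite /fmul linext_gen -[RHS]linext_id.
by apply: eq_linext => x; rewrite mul1g.
Qed.

Lemma fmulr1 : right_id (fgen 1%g) fmul.
Proof.
move=> a; rewrite /fmul -[RHS]linext_id.
by apply: eq_linext => x; rewrite linext_gen mulg1.
Qed.

Lemma fmul0 b : fmul 0 b = 0.
Proof. by rewrite /fmul linear0. Qed.

Lemma fmulA : associative fmul.
Proof.
move=> a b c; elim/free_mod_ind: a => [|s x a IHa]; first by rewrite !fmul0.
rewrite 3!fmulDl 3!fmulZl {}IHa; congr (s *: _ + _) => {s a}.
elim/free_mod_ind: b => [|s y b IHb]; first by rewrite fmul0 linear0 fmul0.
rewrite !(fmulDl, fmulZl, fmulDr, linearZ) /= {}IHb.
congr (s *: _ + _) => {s b}.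
elim/free_mod_ind: c => [|s z c IHc]; first by rewrite !linear0.
by rewrite !(fmulDr, linearZ) /= {}IHc !fmul_gen mulgA.
Qed.

HB.instance Definition _ := GRing.Zmodule_isPzRing.Build (free_mod k K)
  fmulA fmul1 fmulr1 fmulDl fmulDr.

Lemma fgenM (x y : K) : fgen x * fgen y = fgen (x * y)%g.
Proof. exact: fmul_gen. Qed.

End MonoidAlgebra.

(* [free_mod k (K * L)] is used as the tensor product of the free modules on
   K and L, the basis element (x, y) standing for x (x) y. *)
Definition tens (K L : choiceType) (a : free_mod k K) (b : free_mod k L) :
    free_mod k (K * L)%type :=
  linext (fun x => linext (fun y => fgen (x, y)) b) a.

Lemma tens_gen (K L : choiceType) (x : K) (y : L) :
  tens (fgen x) (fgen y) = fgen (x, y).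
Proof. by rewrite /tens !linext_gen. Qed.

(* id (x) f *)
Definition id_tens (K L M : choiceType) (f : free_mod k L -> free_mod k M) :
    free_mod k (K * L)%type -> free_mod k (K * M)%type :=
  linext (fun p => tens (fgen p.1) (f (fgen p.2))).

Section Bimodule.
Context (K : monoidType).

(* a . (b (x) c) = ab (x) c *)
Definition lact (a : free_mod k K) :
    free_mod k (K * K)%type -> free_mod k (K * K)%type :=
  linext (fun p => tens (a * fgen p.1) (fgen p.2)).

(* (b (x) c) . a = b (x) ca *)
Definition ract (t : free_mod k (K * K)%type) (a : free_mod k K) :
    free_mod k (K * K)%type :=
  linext (fun p => tens (fgen p.1) (fgen p.2 * a)) t.

End Bimodule.

End FreeModuleTheory.

Section Mapi.
Context (T U : Type) (f : nat -> T -> U).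

Fixpoint mapi_from (i : nat) (s : seq T) : seq U :=
  if s is x :: s' then f i x :: mapi_from i.+1 s' else [::].

Definition mapi : seq T -> seq U := mapi_from 0.

End Mapi.

(* [TNode w [::]] is the one-vertex tree decorated by w in Omega; decorations
   in X can only occur at leaves. *)
Inductive tree (X Omega : Type) : Type :=
| TLeaf of X
| TNode of Omega & seq (tree X Omega).

Arguments TLeaf {X Omega} x.
Arguments TNode {X Omega} w ts.

Definition forest (X Omega : Type) : Type := seq (tree X Omega).

Section TreeChoice.
Context (X Omega : choiceType).

Fixpoint tree_enc (t : tree X Omega) : GenTree.tree (X + Omega)%type :=
  match t with
  | TLeaf x => GenTree.Leaf (inl x)
  | TNode w ts => GenTree.Node 0 (GenTree.Leaf (inr w) :: map tree_enc ts)
  end.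

Fixpoint tree_dec (g : GenTree.tree (X + Omega)%type) : option (tree X Omega) :=
  match g with
  | GenTree.Leaf (inl x) => Some (TLeaf x)
  | GenTree.Node 0 (GenTree.Leaf (inr w) :: gs) =>
      Some (TNode w (pmap tree_dec gs))
  | _ => None
  end.

Lemma tree_encK : pcancel tree_enc tree_dec.
Proof.
rewrite /pcancel; fix IH 1; case=> [x|w ts] //=; congr (Some (TNode w _)).
by elim: ts => //= t ts IHts; rewrite IH /= IHts.
Qed.

HB.instance Definition _ := Choice.copy (tree X Omega) (pcan_type tree_encK).
HB.instance Definition _ := Choice.copy (forest X Omega) (seq (tree X Omega)).
HB.instance Definition _ := isMonoid.Build (forest X Omega)
  (@catA (tree X Omega)) (@cat0s (tree X Omega)) (@cats0 (tree X Omega)).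

End TreeChoice.

Notation H_RT k X Omega := (free_mod k (forest X Omega)).
Notation H_RT2 k X Omega := (free_mod k (forest X Omega * forest X Omega)%type).

Section Coproduct.
Context (k : comPzRingType) (X Omega : choiceType).
Local Notation H := (H_RT k X Omega).
Local Notation H2 := (H_RT2 k X Omega).
Local Notation forest := (forest X Omega).

Definition Bplus (w : Omega) : H -> H :=
  linext (fun F : forest => fgen k ([:: TNode w F] : forest)).

HB.instance Definition _ w := GRing.isLinear.Build k H H *:%R (Bplus w)
  (linext_is_linear _).

Section DeltaForest.
Context (dtree : tree X Omega -> H2).

Fixpoint delta_forest_of (F : forest) : H2 :=
  match F with
  | [::] => 0
  | [:: T] => dtree T
  | T :: (_ :: _) as F' =>
      lact (fgen k ([:: T] : forest)) (delta_forest_of F')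
      + ract (dtree T) (fgen k (F' : forest))
  end.

End DeltaForest.

Fixpoint delta_tree (T : tree X Omega) : H2 :=
  match T with
  | TLeaf _ => tens 1 1
  | TNode w F => tens (fgen k (F : forest)) 1
                 + id_tens (Bplus w) (delta_forest_of delta_tree F)
  end.

Definition Delta : H -> H2 := linext (delta_forest_of delta_tree).

HB.instance Definition _ := GRing.isLinear.Build k H H2 *:%R Delta
  (linext_is_linear _).

(* sum of b_(1) a b_(2), where Delta b = sum of b_(1) (x) b_(2) *)
Definition rhd_RT (a b : H) : H :=
  linext (fun p => fgen k p.1 * a * fgen k p.2) (Delta b).

Definition bracket_RT (a b : H) : H := rhd_RT a b - rhd_RT b a.

Lemma Delta1 : Delta (fgen k (1%g : forest)) = 0.
Proof. by rewrite /Delta linext_gen. Qed.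

Lemma Delta_leafX (x : X) :
  Delta (fgen k ([:: TLeaf x] : forest)) = tens 1 1.
Proof. by rewrite /Delta linext_gen. Qed.

Lemma Delta_Bplus (w : Omega) (F : forest) :
  Delta (Bplus w (fgen k F))
  = tens (fgen k F) 1 + id_tens (Bplus w) (Delta (fgen k F)).
Proof. by rewrite /Delta /Bplus !linext_gen. Qed.

Lemma Delta_cons (T1 T2 : tree X Omega) (F : forest) :
  let F1 : forest := [:: T1] in let F' : forest := T2 :: F in
  Delta (fgen k ([:: T1, T2 & F] : forest))
  = lact (fgen k F1) (Delta (fgen k F')) + ract (Delta (fgen k F1)) (fgen k F').
Proof. by move=> F1 F'; rewrite /Delta !linext_gen. Qed.

End Coproduct.

(* A vertex is encoded by its address: [:: i] is the root of the i-th tree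
   (from the left, starting at 0), and the j-th child of p is rcons p j. *)
Section Biideals.
Context (X Omega : choiceType).
Local Notation tree := (tree X Omega).
Local Notation forest := (forest X Omega).

Fixpoint tree_addresses (T : tree) : seq (seq nat) :=
  match T with
  | TLeaf _ => [:: [::]]
  | TNode _ ts =>
      [::] :: flatten (mapi (fun i t => map (cons i) (tree_addresses t)) ts)
  end.

Definition addresses (F : forest) : seq (seq nat) :=
  flatten (mapi (fun i t => map (cons i) (tree_addresses t)) F).

Definition vertex (F : forest) : finType := seq_sub (addresses F).

Definition child_edge (F : forest) : rel (vertex F) :=
  fun u v => val v == rcons (val u) (last 0 (val v)).

Definition le_h (F : forest) : rel (vertex F) := connect (@child_edge F).

(* On incomparable addresses: u lies in a tree strictly to the right of the
   tree of v, either in F or, recursively, in the forest obtained by deleting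
   the root of the tree containing both. *)
Fixpoint right_of (p q : seq nat) : bool :=
  match p, q with
  | i :: p', j :: q' => (j < i)%N || (i == j) && right_of p' q'
  | _, _ => false
  end.

Definition le_l (F : forest) : rel (vertex F) := fun u v =>
  [&& ~~ le_h u v, ~~ le_h v u & right_of (val u) (val v)].

Definition le_hl (F : forest) : rel (vertex F) := fun u v =>
  le_h u v || le_l u v.

Definition biideal (F : forest) (I : {set vertex F}) : bool :=
  [forall u, forall v, (u \in I) && le_hl u v ==> (v \in I)].

Definition proper_biideal (F : forest) (I : {set vertex F}) : bool :=
  biideal I && (I != [set: vertex F]).

(* u_1, ..., u_n with u_n <= ... <= u_1 *)
Definition decreasing_vertices (F : forest) : seq (vertex F) :=
  sort (fun u v => le_hl v u) (enum (vertex F)).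

(* For I = I_k one has #|I| = k - 1, so that u_k, the vertex removed together
   with I_k, has index #|I| in the 0-based sequence of vertices. *)
Definition cobiideal (F : forest) (I : {set vertex F}) : {set vertex F} :=
  ~: (I :|: [set v | onth (decreasing_vertices F) #|I| == Some v]).

(* The vertices retained are those of address in P.  The first component holds
   the connected component of the root of T (empty if the root is dropped), the
   second one the other components.  Components whose root lost its parent are
   put to the left of the component they are detached from; the order of such
   components is immaterial for restrictions to a biideal or to a
   [cobiideal]. *)
Fixpoint restrict_tree (P : pred (seq nat)) (T : tree) {struct T} :
    forest * forest :=
  match T with
  | TLeaf x => (if P [::] then [:: TLeaf x] else [::], [::])
  | TNode w ts =>
      let rs := mapi (fun i t => restrict_tree (fun p => P (i :: p)) t) ts in
      if P [::] then
        ([:: TNode w (flatten [seq r.1 | r <- rs])],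
         flatten [seq r.2 | r <- rs])
      else ([::], flatten [seq r.2 ++ r.1 | r <- rs])
  end.

Definition restrict (F : forest) (I : {set vertex F}) : forest :=
  let P : pred (seq nat) := fun p => [exists v in I, val v == p] in
  flatten [seq r.2 ++ r.1
          | r <- mapi (fun i t => restrict_tree (fun p => P (i :: p)) t) F].

End Biideals.

(* Main.v *)
Require Import Defs.
From mathcomp Require Import all_boot all_algebra.

(** The coproduct is a sum over vertices.  Unfolding its recursion, [Delta F] is
    the sum of A (x) B over a list [cuts F] of pairs of forests, one pair for each
    vertex u of F: for a leaf x this pair is (1, 1); in a tree with root w over a
    forest G, either u is the root, giving (G, 1), or u is a vertex of G and w is
    grafted under B; in a concatenation the trees to the left of the one
    containing u are multiplied into A, those to the right into B
    ([delta_cuts]).  Consequently F1 |> F2 is the sum of A F1 B over the cuts of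
    F2 ([rhd_cuts]).

    The order [le_hl] makes descendants and vertices to the left larger, so the
    decreasing list u_1, ..., u_n of vertices is the postorder traversal
    ([map_decreasing_vertices]): the trees from left to right, and in each tree
    the vertices above the root before the root.  Reading addresses, the order is
    lexicographic ([le_hlE]).  The order being total, the biideals are the initial
    segments of this list ([biideal_eq]), and the sum over proper biideals
    becomes a sum over the n ways of splitting the list as
    (u_1 ... u_{k-1}) u_k (u_{k+1} ... u_n) ([big_proper_biideal],
    [cobiideal_initial]).

    It remains to see that restricting F to the two sides of the k-th splitting
    gives the k-th cut ([cuts_restrict]).  This is an induction on F: the
    postorder of a concatenation is a concatenation and the postorder of a tree
    ends with its root, so the splittings of the postorder satisfy the same
    recursion as the cuts. *)

Set Implicit Arguments.
Unset Strict Implicit.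
Unset Printing Implicit Defensive.

Import GRing.Theory.
Local Open Scope ring_scope.

(** * Splitting a sequence at one of its entries *)

Fixpoint splits (T : Type) (s : seq T) : seq (seq T * seq T) :=
  if s is x :: s' then ([::], s') :: [seq (x :: c.1, c.2) | c <- splits s']
  else [::].

Lemma flatten_nils (A B : Type) (s : seq A) :
  flatten [seq [::] | _ <- s] = [::] :> seq B.
Proof. by elim: s. Qed.

Section Splits.
Context (T U : Type).

Lemma splits_cat (s t : seq T) :
  splits (s ++ t) = [seq (c.1, c.2 ++ t) | c <- splits s]
                    ++ [seq (s ++ c.1, c.2) | c <- splits t].
Proof.
elim: s => [|x s IHs] /=; first by rewrite -[LHS]map_id; apply: eq_map => -[].
by rewrite IHs map_cat -!map_comp.
Qed.

Lemma splits_map (f : T -> U) (s : seq T) :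
  splits (map f s) = [seq (map f c.1, map f c.2) | c <- splits s].
Proof. by elim: s => //= x s ->; rewrite -!map_comp. Qed.

(** The recursive form of [splits] suits inductions on forests; this form suits
    the indexing of biideals by their cardinality. *)
Lemma splitsE (s : seq T) :
  splits s = [seq (take j s, drop j.+1 s) | j <- iota 0 (size s)].
Proof.
by elim: s => //= x s ->; rewrite drop0 -[1%N]/(1 + 0)%N iotaDl -!map_comp.
Qed.

(** The hypothesis says that [a] is closed under going back in [s], so that
    selecting by [a] truncates [s].  Applied to the decreasing list of vertices,
    it turns a biideal into an initial segment. *)
Lemma pairwise_filter_take (a : pred T) (s : seq T) :
  pairwise (fun x y => a y ==> a x) s -> filter a s = take (count a s) s.
Proof.
elim: s => //= x s IHs /andP[ax /IHs IH].
case: ifP ax => [_ _|_]; rewrite /= ?IH //.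
rewrite /= (eq_all (a2 := predC a)) => [|y]; last by rewrite /= implybF.
by rewrite all_predC has_count -leqNgt leqn0 => /eqP ->; rewrite !take0.
Qed.

End Splits.

Lemma mem_splits (T : eqType) (s : seq T) c :
  c \in splits s -> {subset c.1 <= s} /\ {subset c.2 <= s}.
Proof.
rewrite splitsE => /mapP[j _ ->].
by split=> x; [apply: mem_take | apply: mem_drop].
Qed.

(** Matches the way [cobiideal] singles out the vertex u_k by its index. *)
Lemma mem_drop_compl (T : eqType) (s : seq T) j x :
  uniq s -> x \in s ->
  (x \in drop j.+1 s) = ~~ ((x \in take j s) || (onth s j == Some x)).
Proof.
elim: s j => //= y s IH [|j] /andP[ys us].
  rewrite drop0 inE /= => /orP[/eqP->|xs]; first by rewrite eqxx (negPf ys).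
  by rewrite xs; apply/esym; apply: contraNneq ys => -[->].
rewrite !inE; case: eqP => [-> _|_] /=; last exact: IH.
by apply/negP => /mem_drop; apply/negP.
Qed.

(** * The total order on addresses *)

(** The order [le_hl] read on addresses: lexicographic, with larger child indices
    first and a prefix before its extensions. *)
Fixpoint le_addr (p q : seq nat) : bool :=
  match p, q with
  | [::], _ => true
  | _, [::] => false
  | i :: p', j :: q' => (j < i)%N || (i == j) && le_addr p' q'
  end.

Lemma le_addrE p q : le_addr p q = prefix p q || right_of p q.
Proof.
elim: p q => [|i p IH] [|j q] //=.
by rewrite IH; case: ltngtP; rewrite ?andbF ?orbT //=.
Qed.

Lemma le_addr_trans : transitive le_addr.
Proof.
elim=> [|j q IH] [|i p] [|l r] //=.
case: (ltngtP j i) => //= [ji _|<-]; last by case: ltngtP => //= _; apply: IH.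
by case: (ltngtP l j) => //= [lj _|->]; rewrite ?ji ?(ltn_trans lj ji).
Qed.

Lemma le_addr_anti : antisymmetric le_addr.
Proof.
by elim=> [|i p IH] [|j q] //=; case: ltngtP => //= -> /IH ->.
Qed.

Lemma le_addr_total : total le_addr.
Proof. by elim=> [|i p IH] [|j q] //=; case: ltngtP => //= _; apply: IH. Qed.

Lemma prefix_right_ofF p q : prefix q p -> right_of p q = false.
Proof.
by elim: p q => [|i p IH] [|j q] //= /andP[/eqP-> /IH->]; rewrite ltnn eqxx.
Qed.

Section Trees.
Context (X Omega : choiceType).
Local Notation tree := (tree X Omega).
Local Notation forest := (forest X Omega).

(** * Cuts and the coproduct *)

(** The induction principle generated for [tree] gives no hypothesis on the
    subtrees, which are nested in a sequence. *)
Lemma tree_forest_ind (P : tree -> Prop) (Q : forest -> Prop) :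
    (forall x, P (TLeaf x)) -> (forall w F, Q F -> P (TNode w F)) ->
    Q [::] -> (forall T F, P T -> Q F -> Q (T :: F)) ->
  (forall T, P T) /\ (forall F, Q F).
Proof.
move=> Pleaf Pnode Qnil Qcons.
have PT: forall T, P T.
  fix IH 1 => -[x|w F]; first exact: Pleaf.
  by apply: Pnode; elim: F => // T F; apply: Qcons.
by split=> //; elim=> // T F; apply: Qcons.
Qed.

(** [cuts F] lists the tensors of [Delta F], with the recursion of [Delta]: the
    vertex removed lies either in the first tree or in the rest of the forest,
    and in a tree it lies either strictly above the root or is the root.  The
    function on trees is a section variable so that [cuts_tree] is accepted as
    structurally recursive. *)
Section CutsForest.
Context (cuts_tree : tree -> seq (forest * forest)).

Fixpoint cuts_forest_of (F : forest) : seq (forest * forest) :=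
  if F is T :: F' then
    [seq (c.1, c.2 ++ F') | c <- cuts_tree T]
    ++ [seq (T :: c.1, c.2) | c <- cuts_forest_of F']
  else [::].

End CutsForest.

Fixpoint cuts_tree (T : tree) : seq (forest * forest) :=
  match T with
  | TLeaf _ => [:: ([::], [::])]
  | TNode w F =>
      rcons [seq (c.1, [:: TNode w c.2]) | c <- cuts_forest_of cuts_tree F]
            (F, [::])
  end.

Definition cuts (F : forest) := cuts_forest_of cuts_tree F.

Section Coproduct.
Context (k : comPzRingType).

Lemma linext_sum (K : choiceType) (V : lmodType k) (phi : K -> V)
    (I : Type) (r : seq I) (h : I -> K) :
  linext phi (\sum_(i <- r) fgen k (h i)) = \sum_(i <- r) phi (h i).
Proof. by rewrite linear_sum; apply: eq_bigr => i _; rewrite /= linext_gen. Qed.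

Lemma delta_cuts :
  (forall T : tree, delta_tree k T = \sum_(c <- cuts_tree T) fgen k c) /\
  (forall F : forest,
    delta_forest_of (@delta_tree k X Omega) F = \sum_(c <- cuts F) fgen k c).
Proof.
apply: tree_forest_ind => [x|w F IH||T F IHT IHF] /=.
- by rewrite big_seq1 tens_gen.
- rewrite -cats1 big_cat /= big_seq1 big_map IH /id_tens linext_sum addrC.
  rewrite tens_gen; congr (_ + _); apply: eq_bigr => c _.
  by rewrite /Bplus linext_gen tens_gen.
- by rewrite big_nil.
- rewrite /cuts /= big_cat !big_map /= -/(cuts F).
  (* The definition of Delta treats one-tree forests separately, while the
     general rule of [cuts] covers them too. *)
  case: F IHF => [_|T' F IHF].
    by rewrite big_nil addr0 IHT; apply: eq_bigr => -[a b] _ /=; rewrite cats0.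
  rewrite IHF IHT addrC /lact /ract !linext_sum.
  by congr (_ + _); apply: eq_bigr => c _; rewrite fgenM tens_gen.
Qed.

Lemma rhd_cuts (F1 F2 : forest) :
  rhd_RT (fgen k F1) (fgen k F2)
  = \sum_(c <- cuts F2) fgen k c.1 * fgen k F1 * fgen k c.2.
Proof. by rewrite /rhd_RT /Delta linext_gen delta_cuts.2 linext_sum. Qed.

End Coproduct.

(** * Restriction along the postorder *)

(** Since descendants and vertices to the left are larger, the decreasing list of
    vertices is the postorder traversal. *)
Fixpoint tree_postorder (T : tree) : seq (seq nat) :=
  match T with
  | TLeaf _ => [:: [::]]
  | TNode _ F =>
      rcons (flatten (mapi (fun i t => map (cons i) (tree_postorder t)) F)) [::]
  end.

(** A starting index is carried along because the tail of a forest keeps the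
    addresses it has in the whole forest. *)
Definition postorder_from (i : nat) (F : forest) : seq (seq nat) :=
  flatten (mapi_from (fun j t => map (cons j) (tree_postorder t)) i F).

Definition addresses_from (i : nat) (F : forest) : seq (seq nat) :=
  flatten (mapi_from (fun j t => map (cons j) (tree_addresses t)) i F).

Definition restrict_from (P : pred (seq nat)) (i : nat) (F : forest) :
    seq (forest * forest) :=
  mapi_from (fun j t => restrict_tree (fun p => P (j :: p)) t) i F.

Definition restrict_pred (P : pred (seq nat)) (i : nat) (F : forest) : forest :=
  flatten [seq r.2 ++ r.1 | r <- restrict_from P i F].

Lemma mem_map_cons (i j : nat) (p : seq nat) (s : seq (seq nat)) :
  (i :: p \in map (cons j) s) = (i == j) && (p \in s).
Proof.
apply/mapP/andP => [[q qs [-> ->]]|[/eqP-> ps]]; first by rewrite eqxx.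
by exists p.
Qed.

Lemma nil_postorder_from i (F : forest) : ([::] \in postorder_from i F) = false.
Proof.
by elim: F i => //= T F IH i; rewrite mem_cat IH orbF; apply/mapP => -[].
Qed.

Lemma postorder_from_ge i j p (F : forest) :
  j :: p \in postorder_from i F -> (i <= j)%N.
Proof.
elim: F i => //= T F IH i; rewrite mem_cat mem_map_cons.
by case/orP=> [/andP[/eqP->]|/IH/ltnW].
Qed.

(** Replaces the membership predicate of a concatenation by that of the one part
    whose addresses occur in the trees considered. *)
Lemma eq_restrict :
  (forall (T : tree) (P Q : pred (seq nat)), P =1 Q ->
     restrict_tree P T = restrict_tree Q T) /\
  (forall (F : forest) (P Q : pred (seq nat)) i,
     (forall j p, (i <= j)%N -> P (j :: p) = Q (j :: p)) ->
     restrict_from P i F = restrict_from Q i F).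
Proof.
apply: tree_forest_ind => //.
- by move=> x P Q PQ /=; rewrite PQ.
- move=> w F IH P Q PQ /=; rewrite PQ.
  by rewrite /mapi [mapi_from _ _ _](IH P Q).
- move=> T F IHT IHF P Q i PQ /=; congr (_ :: _).
    by apply: IHT => p; apply: PQ.
  by apply: IHF => j p ltij; apply: PQ; apply: ltnW.
Qed.

Lemma restrict_full :
  (forall (T : tree) (P : pred (seq nat)),
     {in tree_postorder T, forall p, P p} -> restrict_tree P T = ([:: T], [::])) /\
  (forall (F : forest) (P : pred (seq nat)) i,
     {in postorder_from i F, forall p, P p} ->
     restrict_from P i F = [seq ([:: T], [::]) | T <- F]).
Proof.
apply: tree_forest_ind => [x P /= -> //|w F IH P PF||T F IHT IHF P i PTF] //=.
- rewrite PF ?mem_rcons ?mem_head // /mapi [mapi_from _ _ _]IH; last first.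
    by move=> p pF; apply: PF; rewrite mem_rcons inE pF orbT.
  by rewrite -!map_comp /= flatten_map1 map_id flatten_nils.
- congr (_ :: _).
    by apply: IHT => p pT; apply: PTF; rewrite mem_cat mem_map_cons eqxx pT.
  by apply: IHF => p pF; apply: PTF; rewrite mem_cat pF orbT.
Qed.

Lemma restrict_empty :
  (forall (T : tree) (P : pred (seq nat)),
     {in tree_postorder T, forall p, ~~ P p} -> restrict_tree P T = ([::], [::])) /\
  (forall (F : forest) (P : pred (seq nat)) i,
     {in postorder_from i F, forall p, ~~ P p} ->
     restrict_from P i F = [seq ([::], [::]) | T <- F]).
Proof.
apply: tree_forest_ind => [x P /= nP|w F IH P PF||T F IHT IHF P i PTF] //=.
- by rewrite (negPf (nP _ _)) ?mem_head.
- rewrite (negPf (PF _ _)) ?mem_rcons ?mem_head // /mapi [mapi_from _ _ _]IH.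
    by rewrite -map_comp flatten_nils.
  by move=> p pF; apply: PF; rewrite mem_rcons inE pF orbT.
- congr (_ :: _).
    by apply: IHT => p pT; apply: PTF; rewrite mem_cat mem_map_cons eqxx pT.
  by apply: IHF => p pF; apply: PTF; rewrite mem_cat pF orbT.
Qed.

(** The heart of the proof.  Postorder decomposes like [cuts]: along a forest by
    concatenation ([splits_cat]), at a node by a final root.  So the vertex where
    the postorder is split falls in one subtree, every subtree to its left
    belongs to the initial part and every one to its right to the final part
    ([restrict_full], [restrict_empty]).

    The statement keeps the two components of [restrict_tree] apart.  In the tree
    that is split, the initial part misses the root, so it only has detached
    components; the final part has none, because it is closed under taking
    parents.  On forests the initial part is needed in the order in which
    [restrict_tree] collects it once the root is dropped, the final part in the
    order used once the root is kept. *)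
Lemma cuts_restrict :
  (forall T : tree,
     [seq (restrict_tree (mem c.1) T, restrict_tree (mem c.2) T)
     | c <- splits (tree_postorder T)]
     = [seq (([::], c.1), (c.2, [::])) | c <- cuts_tree T]) /\
  (forall (F : forest) i,
     [seq (flatten [seq r.2 ++ r.1 | r <- restrict_from (mem c.1) i F],
           (flatten [seq r.1 | r <- restrict_from (mem c.2) i F],
            flatten [seq r.2 | r <- restrict_from (mem c.2) i F]))
     | c <- splits (postorder_from i F)]
     = [seq (c.1, (c.2, [::])) | c <- cuts F]).
Proof.
apply: tree_forest_ind => [x|w F IH||T F IHT IHF i] //=.
- rewrite -[flatten _]/(postorder_from 0 F) -!cats1 splits_cat !map_cat /=.
  congr (_ ++ _).
    rewrite -!map_comp.
    (* The root is the last vertex: it is not in the initial part, and is grafted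
       back under the final part. *)
    pose g (c : forest * (forest * forest)) :=
      (([::] : forest, c.1), ([:: TNode w c.2.1], c.2.2)).
    rewrite [RHS](_ : _ = map g [seq (c.1, (c.2, [::])) | c <- cuts F]); last first.
      by rewrite -map_comp.
    rewrite -(IH 0) -map_comp; apply/eq_in_map => c /mem_splits[c1F _] /=.
    have -> : ([::] \in c.1) = false.
      by apply: contraFF (nil_postorder_from 0 F) => /c1F.
    rewrite mem_cat mem_head orbT /g /=.
    rewrite /mapi -/(restrict_from (mem c.1) 0 F).
    rewrite -/(restrict_from (mem (c.2 ++ [:: [::]])) 0 F).
    rewrite (eq_restrict.2 _ (mem (c.2 ++ _)) (mem c.2)) // => j p _ /=.
    by rewrite mem_cat in_cons orbF.
  (* The remaining split removes the root itself. *)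
  rewrite cats0 nil_postorder_from /mapi.
  rewrite -/(restrict_from (mem (postorder_from 0 F)) 0 F).
  rewrite (restrict_full.2 _ _ _ (fun p => id)) -map_comp flatten_map1 map_id.
  by rewrite [mapi_from _ _ _](restrict_empty.2) //= -map_comp flatten_nils.
- rewrite -/(postorder_from i.+1 F) splits_cat splits_map !map_cat; congr (_ ++ _).
    (* The split falls in T: the trees of F all go to the final part. *)
    rewrite -!map_comp.
    pose g (c : (forest * forest) * (forest * forest)) :=
      (c.1.2 ++ c.1.1, (c.2.1 ++ F, c.2.2)).
    rewrite [RHS](_ : _ =
        map g [seq (([::], c.1), (c.2, [::])) | c <- cuts_tree T]); last first.
      by rewrite -map_comp; apply: eq_map => c; rewrite /g /= cats0.
    rewrite -IHT -map_comp; apply: eq_map => c /=.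
    have full : forall s, restrict_from (mem (s ++ postorder_from i.+1 F)) i.+1 F
        = [seq ([:: T], [::]) | T <- F].
      by move=> s; apply: restrict_full.2 => p pF; rewrite /= mem_cat pF orbT.
    rewrite -!/(restrict_from _ i.+1 F) full.
    rewrite (restrict_empty.2); last first.
      move=> [|j p]; first by rewrite nil_postorder_from.
      by move/postorder_from_ge => ltij; rewrite /= mem_map_cons gtn_eqF.
    rewrite /g -!map_comp flatten_map1 map_id !flatten_nils !cats0.
    congr (_, (_, _)).
    + by congr (_ ++ _); rewrite (eq_restrict.1 _ _ (mem c.1)) // => p;
        rewrite /= mem_map_cons eqxx.
    + congr (_ ++ _); rewrite (eq_restrict.1 _ _ (mem c.2)) // => p.
      rewrite /= mem_cat mem_map_cons eqxx; case: (p \in _) => //=.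
      by apply/negP => /postorder_from_ge; rewrite ltnn.
    + rewrite (eq_restrict.1 _ _ (mem c.2)) // => p.
      rewrite /= mem_cat mem_map_cons eqxx; case: (p \in _) => //=.
      by apply/negP => /postorder_from_ge; rewrite ltnn.
- rewrite -!map_comp.
  (* The split falls in F: the whole of T goes to the initial part. *)
  pose g (c : forest * (forest * forest)) := (T :: c.1, c.2).
  rewrite [RHS](_ : _ = map g [seq (c.1, (c.2, [::])) | c <- cuts F]); last first.
    by rewrite -map_comp.
  rewrite -(IHF i.+1) -map_comp; apply/eq_in_map => c /mem_splits[c1F c2F] /=.
  rewrite -!/(restrict_from _ i.+1 F).
  rewrite restrict_full.1; last first.
    by move=> p pT; rewrite /= mem_cat mem_map_cons eqxx pT.
  rewrite restrict_empty.1; last first.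
    by move=> p pT; apply/negP => /c2F/postorder_from_ge; rewrite ltnn.
  rewrite /g /= (eq_restrict.2 _ (mem (_ ++ _)) (mem c.1)) // => j p ltij.
  by rewrite /= mem_cat mem_map_cons gtn_eqF.
Qed.

Lemma cuts_restrict_pred (F : forest) :
  [seq (restrict_pred (mem c.1) 0 F, restrict_pred (mem c.2) 0 F)
  | c <- splits (postorder_from 0 F)] = cuts F.
Proof.
have FE := cuts_restrict.2 F 0.
pose g (c : forest * (forest * forest)) := (c.1, c.2.1).
rewrite -[RHS]map_id [RHS](_ : _ = map g [seq (c.1, (c.2, [::])) | c <- cuts F]).
  rewrite -FE -map_comp; apply/eq_in_map => c cF; rewrite /g /=; congr (_, _).
  (* No component of the final part is detached, so both ways of collecting the
     components agree. *)
  have [c' _ [_ _]] := mapP (eq_ind _ (fun s => _ \in s) (map_f _ cF) _ FE).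
  rewrite /restrict_pred; elim: restrict_from => //= r rs IH.
  by case: r.2 => //= /IH ->.
by rewrite -map_comp; apply: eq_map => -[].
Qed.

(** * Biideals as initial segments of the postorder *)

Lemma perm_postorder :
  (forall T : tree, perm_eq (tree_postorder T) (tree_addresses T)) /\
  (forall (F : forest) i, perm_eq (postorder_from i F) (addresses_from i F)).
Proof.
apply: tree_forest_ind => [x|w F IH||T F IHT IHF i] //=.
- by rewrite perm_rcons perm_cons; apply: IH.
- by apply: perm_cat; [apply: perm_map | apply: IHF].
Qed.

Lemma pairwise_postorder :
  (forall T : tree, pairwise (fun p q => le_addr q p) (tree_postorder T)) /\
  (forall (F : forest) i, pairwise (fun p q => le_addr q p) (postorder_from i F)).
Proof.
apply: tree_forest_ind => [x|w F IH||T F IHT IHF i] //=.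
- rewrite -cats1 pairwise_cat [pairwise _ _](IH 0) /= andbT.
  by apply/allrelP => p q _; rewrite inE => /eqP ->.
- rewrite pairwise_cat [pairwise _ (flatten _)]IHF andbT; apply/andP; split.
    apply/allrelP => _ [|j q] /mapP[p _ ->].
      by rewrite nil_postorder_from.
    by move=> /postorder_from_ge ltij /=; rewrite ltij.
  by rewrite pairwise_map; apply: sub_pairwise IHT => p q /=; rewrite ltnn eqxx.
Qed.

Lemma uniq_postorder :
  (forall T : tree, uniq (tree_postorder T)) /\
  (forall (F : forest) i, uniq (postorder_from i F)).
Proof.
apply: tree_forest_ind => [x|w F IH||T F IHT IHF i] //=.
- by rewrite rcons_uniq [_ \in _]nil_postorder_from; apply: IH.
- rewrite cat_uniq [uniq (flatten _)]IHF andbT map_inj_uniq ?IHT /=; last first.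
    by move=> p q [].
  apply/hasPn => -[|j q]; first by rewrite [_ \in _]nil_postorder_from.
  by move=> /postorder_from_ge ltij; rewrite /= mem_map_cons gtn_eqF.
Qed.

(** By iteration, every nonempty prefix of the address of a vertex is the address
    of a vertex, so that a path can be rebuilt from a prefix in [le_h_prefix].  At the forest
    level the empty address has to be excluded: it stands for no vertex. *)
Lemma addresses_parent :
  (forall T : tree, forall p x, rcons p x \in tree_addresses T ->
     p \in tree_addresses T) /\
  (forall (F : forest) i p x, p != [::] ->
     rcons p x \in addresses_from i F ->
     p \in addresses_from i F).
Proof.
apply: tree_forest_ind => [y|w F IH||T F IHT IHF i] //=.
- by case.
- move=> [|j p] x //; rewrite !inE /=; exact: (IH 0 (j :: p) x isT).
- move=> [|j p] x // _; rewrite rcons_cons !mem_cat !mem_map_cons.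
  case/orP=> [/andP[-> /IHT ->] //|/(IHF i.+1 (j :: p) x isT)].
  by rewrite -/(addresses_from i.+1 F) => ->; rewrite orbT.
Qed.

Section Vertices.
Context (F : forest).
Local Notation V := (vertex F).
Implicit Types (u v : V) (I : {set V}).

Lemma vertex_neq_nil v : val v != [::].
Proof.
case: v => p pF /=; apply: contraTneq pF => ->.
by rewrite /addresses -(perm_mem (perm_postorder.2 F 0)) nil_postorder_from.
Qed.

Lemma le_h_prefix u v : le_h u v = prefix (val u) (val v).
Proof.
apply/connectP/prefixP => [[s us ->] {v}|[s]].
  elim: s u us => [|w s IH] u /=; first by exists [::]; rewrite cats0.
  by case/andP=> /eqP wE /IH[t ->]; rewrite wE cat_rcons; eexists.
elim/last_ind: s v => [|s x IH] v vE.
  by exists [::] => //=; apply: val_inj; rewrite vE cats0.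
rewrite -rcons_cat in vE.
have pF : val u ++ s \in addresses F.
  apply: (addresses_parent.2 F 0 _ x); last by rewrite -vE (valP v).
  by case: (val u) (vertex_neq_nil u).
have [t ut vt] := IH (SeqSub pF) erefl.
exists (rcons t v); last by rewrite last_rcons.
by rewrite rcons_path ut -vt /child_edge vE last_rcons /=.
Qed.

(** The incomparability conditions in [le_l] are automatic: [right_of] fails on
    addresses one of which is a prefix of the other. *)
Lemma le_hlE u v : le_hl u v = le_addr (val u) (val v).
Proof.
rewrite /le_hl /le_l !le_h_prefix le_addrE.
case: (boolP (prefix _ (val v))) => //= _.
by case: (boolP (prefix _ _)) => //= /prefix_right_ofF ->.
Qed.

(** Both sides are sorted for the same total order and have the same entries. *)
Lemma map_decreasing_vertices :
  map val (decreasing_vertices F) = postorder_from 0 F.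
Proof.
pose r : rel (seq nat) := fun p q => le_addr q p.
apply: (@sorted_eq _ r).
- by move=> q p s pq qs; apply: le_addr_trans pq.
- by move=> p q; rewrite andbC => /le_addr_anti.
- rewrite sorted_map (eq_sorted (e' := fun u v : V => le_hl v u)) => [|u v].
    by apply: sort_sorted => u v; rewrite !le_hlE; apply: le_addr_total.
  by rewrite /= le_hlE.
- by apply: pairwise_sorted; apply: pairwise_postorder.2.
apply: uniq_perm.
- by rewrite map_inj_uniq ?sort_uniq ?enum_uniq //; apply: val_inj.
- exact: uniq_postorder.2.
move=> p; rewrite (perm_mem (perm_postorder.2 F 0)).
apply/mapP/idP => [[v _ ->]|pF]; first exact: (valP v).
by exists (SeqSub pF); rewrite ?mem_sort ?mem_enum.
Qed.

Definition initial (j : nat) : {set V} :=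
  [set v in take j (decreasing_vertices F)].

Local Notation D := (decreasing_vertices F).

Lemma uniq_decreasing_vertices : uniq D.
Proof. by rewrite sort_uniq enum_uniq. Qed.

Lemma mem_decreasing_vertices v : v \in D.
Proof. by rewrite mem_sort mem_enum. Qed.

Lemma pairwise_decreasing_vertices : pairwise (fun u v => le_hl v u) D.
Proof.
rewrite (@sub_pairwise _ (relpre val (fun p q => le_addr q p))) //.
  by move=> u v; rewrite le_hlE.
by rewrite -pairwise_map map_decreasing_vertices pairwise_postorder.2.
Qed.

Lemma card_initial j : (j <= size D)%N -> #|initial j| = j.
Proof.
move=> le_jD; rewrite cardsE (card_uniqP _) ?size_takel //.
exact/take_uniq/uniq_decreasing_vertices.
Qed.

Lemma biideal_initial j : biideal (initial j).
Proof.
apply/forallP => u; apply/forallP => v; apply/implyP; rewrite !inE.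
case/andP=> uj le_uv; move: (mem_decreasing_vertices v).
have := pairwise_decreasing_vertices; rewrite -{1 2}(cat_take_drop j D).
rewrite pairwise_cat mem_cat => /and3P[/allrelP le_D _ _] /orP[//|vj].
have := le_D _ _ uj vj; rewrite le_hlE => le_vu.
have /val_inj <- // : val u = val v.
by apply: le_addr_anti; rewrite le_vu -le_hlE le_uv.
Qed.

Lemma biideal_eq I : biideal I -> I = initial #|I|.
Proof.
move=> /forallP bI; have sI : count (mem I) D = #|I|.
  rewrite -size_filter cardE; apply/perm_size/uniq_perm.
  - by rewrite filter_uniq ?uniq_decreasing_vertices.
  - exact: enum_uniq.
  by move=> v; rewrite mem_filter mem_decreasing_vertices mem_enum andbT.
apply/setP => v; rewrite inE -sI -pairwise_filter_take.
  by rewrite mem_filter mem_decreasing_vertices andbT.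
apply: sub_pairwise pairwise_decreasing_vertices => u w le_wu.
by apply/implyP => wI; have /forallP/(_ u)/implyP := bI w; apply; apply/andP.
Qed.

Lemma proper_biidealP I :
  reflect (exists2 j, (j < size D)%N & I = initial j) (proper_biideal I).
Proof.
have cV : #|[set: V]| = size D by rewrite cardsT size_sort cardE.
apply: (iffP andP) => [[bI nI]|[j lt_jD ->]].
  exists #|I|; last exact: biideal_eq.
  by rewrite -cV proper_card // properT.
split; first exact: biideal_initial.
apply: contraTneq lt_jD => /(congr1 (fun I => #|I|)).
by rewrite cV -leqNgt; case: (leqP j (size D)) => [/card_initial-> ->|/ltnW].
Qed.

Lemma big_proper_biideal (M : nmodType) (f : {set V} -> M) :
  \sum_(I | proper_biideal I) f I = \sum_(0 <= j < size D) f (initial j).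
Proof.
rewrite -(big_map initial predT f).
have uj : uniq [seq initial j | j <- index_iota 0 (size D)].
  rewrite map_inj_in_uniq ?iota_uniq // => i j; rewrite !mem_index_iota /=.
  move=> /ltnW/card_initial ci /ltnW/card_initial cj eq_ij.
  by rewrite -ci eq_ij cj.
rewrite (big_uniq _ uj); apply: eq_bigl => I; apply/proper_biidealP/mapP.
  by case=> j lt_jD ->; exists j; rewrite ?mem_index_iota.
by case=> j; rewrite mem_index_iota => /= lt_jD ->; exists j.
Qed.

Lemma cobiideal_initial j : (j < size D)%N ->
  cobiideal (initial j) = [set v in drop j.+1 D].
Proof.
move=> lt_jD; apply/setP => v; rewrite !inE card_initial 1?ltnW //.
by rewrite (mem_drop_compl _ uniq_decreasing_vertices) ?mem_decreasing_vertices.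
Qed.

Lemma restrict_set (s : seq V) :
  restrict [set v in s] = restrict_pred (mem (map val s)) 0 F.
Proof.
rewrite /restrict /restrict_pred -[mapi _ _]/(restrict_from
  (fun p => [exists v in [set v in s], val v == p]) 0 F).
rewrite (eq_restrict.2 F _ (mem (map val s))) // => j p _; apply/existsP/mapP.
  by case=> v /andP[]; rewrite inE => vs /eqP <-; exists v.
by case=> v vs ->; exists v; rewrite inE vs eqxx.
Qed.

End Vertices.

(** The j-th proper biideal and its co-biideal are the two parts of the j-th split
    of the postorder, and these restrict to the j-th cut. *)
Lemma cuts_sum (M : nmodType) (f : forest -> forest -> M) (F : forest) :
  \sum_(I : {set vertex F} | proper_biideal I)
     f (restrict I) (restrict (cobiideal I))
  = \sum_(c <- cuts F) f c.1 c.2.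
Proof.
rewrite big_proper_biideal.
rewrite -cuts_restrict_pred big_map splitsE big_map -map_decreasing_vertices.
rewrite size_map /index_iota subn0; apply: eq_big_seq => j.
rewrite mem_iota add0n => lt_jD.
by rewrite cobiideal_initial // !restrict_set map_take map_drop.
Qed.

End Trees.

Theorem corollary5p13 (k : comPzRingType) (X Omega : choiceType)
    (Omega_nonempty : inhabited Omega) (F1 F2 : forest X Omega) :
  rhd_RT (fgen k F1) (fgen k F2)
    = \sum_(I2 : {set vertex F2} | proper_biideal I2)
        fgen k (restrict I2) * fgen k F1 * fgen k (restrict (cobiideal I2))
  /\
  bracket_RT (fgen k F1) (fgen k F2)
    = \sum_(I2 : {set vertex F2} | proper_biideal I2)
        fgen k (restrict I2) * fgen k F1 * fgen k (restrict (cobiideal I2))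
      - \sum_(I1 : {set vertex F1} | proper_biideal I1)
        fgen k (restrict I1) * fgen k F2 * fgen k (restrict (cobiideal I1)).
Proof.
have rhdE F G : rhd_RT (fgen k F) (fgen k G)
    = \sum_(I : {set vertex G} | proper_biideal I)
        fgen k (restrict I) * fgen k F * fgen k (restrict (cobiideal I)).
  rewrite rhd_cuts.
  by rewrite (cuts_sum (fun A B => fgen k A * fgen k F * fgen k B)).
by rewrite /bracket_RT !rhdE.
Qed.
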